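(* Let $m\ge3$, $\delta\in(0,\frac18]$ and $K\in\mathbb{N}$. Then for any parameter $\epsilon$ with $0<\epsilon<\frac{1}{4K}\delta^2$ there is an instance of the resource sharing problem with $m$ resources with the following properties: (1) its decreasingly minimal solution is $\lambda=(1,1,0,\dots,0)$; (2) the core algorithm (described in the context), run with an exact block solver and parameters $\epsilon$ and any $T\in\left\{\left\lceil\frac{\log m}{\epsilon^2}\right\rceil,\dots,\left\lceil\frac{K\log m}{\epsilon^2}\right\rceil\right\}$, returns a solution $x^{(T)}$ satisfying $\min_{r\in\mathcal{R}}x^{(T)}_r\ge1-2\delta$.
   Context: Resource sharing problem: finite sets $\mathcal{C}$ (customers) and $\mathcal{R}$ (resources), $m=|\mathcal{R}|$; for each $C$ a nonempty closed convex $X_C\subseteq\mathbb{R}^{\mathcal{R}}_{\ge0}$; $\mathcal{X}=\sum_CX_C$ (Minkowski sum); oracles $f_C:\mathbb{R}^m_{\ge0}\to X_C$; the block solver is exact if $\langle y,f_C(y)\rangle=\min_{x\in X_C}\langle y,x\rangle$ for all $y$. $\log$ is the natural logarithm. For $x\in\mathbb{R}^m$, $x_\downarrow$ is $x$ sorted decreasingly; $x\le_{dec}y$ if $x_\downarrow=y_\downarrow$ or there is $k$ with $(x_\downarrow)_k<(y_\downarrow)_k$ and $(x_\downarrow)_j=(y_\downarrow)_j$ for $j<k$; the decreasingly minimal element of $\mathcal{X}$ is the (unique) $\lambda\in\mathcal{X}$ with $\lambda\le_{dec}y$ for all $y\in\mathcal{X}$. Core algorithm with parameters $\epsilon>0$,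 $T\in\mathbb{N}$: initialize $y=\mathbb{1}\in\mathbb{R}^m$. For phases $t=1,\dots,T$: for each customer $C$ (in a fixed order) set $\alpha=0$, $s^{(t)}_C=0$ and, while $\alpha<1$: $b\gets f_C(y)$; $\xi\gets\min\{1-\alpha,1/\|b\|_\infty\}$; $y_r\gets y_r\exp(\epsilon\xi b_r)$ for all $r$; $s^{(t)}_C\gets s^{(t)}_C+\xi b$; $\alpha\gets\alpha+\xi$. Then $s^{(t)}=\sum_Cs^{(t)}_C$. Output $x^{(T)}=\frac1T\sum_{t=1}^Ts^{(t)}$. *)

(* Defs.v *)
From HB Require Import structures.
From mathcomp Require Export all_boot all_order all_algebra.
From mathcomp Require Export boolp classical_sets reals topology normedtype.
From mathcomp Require Export sequences convex exp.

Set Implicit Arguments.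
Unset Strict Implicit.
Unset Printing Implicit Defensive.

Import Order.TTheory GRing.Theory Num.Theory.
Import numFieldNormedType.Exports.

Local Open Scope classical_set_scope.
Local Open Scope ring_scope.

Definition nonneg_vec (R : realType) (m : nat) (x : 'rV[R]_m) : Prop :=
  forall r : 'I_m, 0 <= x 0 r.

Definition inner (R : realType) (m : nat) (x y : 'rV[R]_m) : R :=
  \sum_(r < m) x 0 r * y 0 r.

(* The resource set is 'I_m. *)
Record instance (R : realType) (m : nat) := Instance {
  customer : finType;
  block : customer -> set 'rV[R]_m;
  block_neq0 : forall C, block C !=set0;
  block_closed : forall C, closed (block C);
  block_convex : forall C, convex_set (block C);
  block_ge0 : forall C x, block C x -> nonneg_vec x
}.

(* The Minkowski sum of the blocks. *)
Definition solutions (R : realType) (m : nat) (I : instance R m) :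
    set 'rV[R]_m :=
  [set x | exists2 z : customer I -> 'rV[R]_m,
     (forall C, block C (z C)) & x = \sum_C z C].

Definition sort_dec (R : realType) (m : nat) (x : 'rV[R]_m) : seq R :=
  sort >=%R [seq x 0 r | r <- enum 'I_m].

Definition dec_le (R : realType) (m : nat) (x y : 'rV[R]_m) : Prop :=
  sort_dec x = sort_dec y \/
  exists k : 'I_m, (sort_dec x)`_k < (sort_dec y)`_k /\
    forall j : nat, (j < k)%N -> (sort_dec x)`_j = (sort_dec y)`_j.

Definition dec_minimal (R : realType) (m : nat) (A : set 'rV[R]_m)
    (x : 'rV[R]_m) : Prop :=
  A x /\ forall y, A y -> dec_le x y.

(* Oracles are defined on the nonnegative orthant only: the values of [f C]
   elsewhere are unconstrained, and the algorithm never queries them. *)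
Definition block_solver (R : realType) (m : nat) (I : instance R m)
    (f : customer I -> 'rV[R]_m -> 'rV[R]_m) : Prop :=
  forall C y, nonneg_vec y -> block C (f C y).

Definition exact_block_solver (R : realType) (m : nat) (I : instance R m)
    (f : customer I -> 'rV[R]_m -> 'rV[R]_m) : Prop :=
  block_solver f /\
  forall C y, nonneg_vec y ->
    forall x, block C x -> inner y (f C y) <= inner y x.

(* min {1 - alpha, 1 / ||b||_oo}, where 1 / 0 = +oo; the norm of 'rV[R]_m is
   the maximum norm. *)
Definition step_size (R : realType) (m : nat) (alpha : R) (b : 'rV[R]_m) : R :=
  if b == 0 then 1 - alpha else Num.min (1 - alpha) (1 / `|b|).

Definition update_prices (R : realType) (m : nat) (eps xi : R)
    (b y : 'rV[R]_m) : 'rV[R]_m :=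
  \row_r (y 0 r * expR (eps * xi * b 0 r)).

(* [customer_loop eps g alpha y s y' s']: the while loop of a customer with
   oracle g, entered with the values alpha, y, s of its variables, terminates
   with final values y', s' of y, s. *)
Inductive customer_loop (R : realType) (m : nat) (eps : R)
    (g : 'rV[R]_m -> 'rV[R]_m) :
    R -> 'rV[R]_m -> 'rV[R]_m -> 'rV[R]_m -> 'rV[R]_m -> Prop :=
| loop_exit alpha y s :
    1 <= alpha -> customer_loop eps g alpha y s y s
| loop_step alpha y s y' s' :
    alpha < 1 ->
    (let b := g y in
     let xi := step_size alpha b in
     customer_loop eps g (alpha + xi) (update_prices eps xi b y) (s + xi *: b)
       y' s') ->
    customer_loop eps g alpha y s y' s'.

(* [phase eps f cs y y' s]: processing the customers of cs in this order,
   starting with prices y, terminates with prices y', and s is the sum of the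
   vectors s_C over cs. *)
Fixpoint phase (R : realType) (m : nat) (I : instance R m) (eps : R)
    (f : customer I -> 'rV[R]_m -> 'rV[R]_m) (cs : seq (customer I))
    (y y' s : 'rV[R]_m) : Prop :=
  if cs is C :: cs' then
    exists y1 sC s1 : 'rV[R]_m,
      [/\ customer_loop eps (f C) 0 y 0 y1 sC,
          phase eps f cs' y1 y' s1
        & s = sC + s1]
  else y' = y /\ s = 0.

(* [core_returns eps f order T x]: the core algorithm terminates with output
   x; Y t is the price vector after t phases, S t is s^(t). *)
Definition core_returns (R : realType) (m : nat) (I : instance R m) (eps : R)
    (f : customer I -> 'rV[R]_m -> 'rV[R]_m) (order : seq (customer I))
    (T : nat) (x : 'rV[R]_m) : Prop :=
  exists Y S : nat -> 'rV[R]_m,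
    [/\ Y 0%N = const_mx 1,
        forall t, (t < T)%N -> phase eps f order (Y t) (Y t.+1) (S t.+1)
      & x = T%:R^-1 *: \sum_(1 <= t < T.+1) S t].

Lemma customer_loop_det (R : realType) (m : nat) (eps : R)
    (g : 'rV[R]_m -> 'rV[R]_m) alpha y s y1 s1 y2 s2 :
  customer_loop eps g alpha y s y1 s1 -> customer_loop eps g alpha y s y2 s2 ->
  y1 = y2 /\ s1 = s2.
Proof.
move=> H; elim: H y2 s2 => {alpha y s y1 s1} [alpha y s a1|alpha y s y1 s1 a1 _ IH] y2 s2 H.
  by inversion H; subst=> //; move: a1; rewrite leNgt => /negP.
inversion H; subst; last exact: IH.
by move: a1; rewrite ltNge => /negP.
Qed.

Lemma phase_det (R : realType) (m : nat) (I : instance R m) (eps : R)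
    (f : customer I -> 'rV[R]_m -> 'rV[R]_m) cs y y1 s1 y2 s2 :
  phase eps f cs y y1 s1 -> phase eps f cs y y2 s2 -> y1 = y2 /\ s1 = s2.
Proof.
elim: cs y s1 s2 => [|C cs IH] y s1 s2 /=; first by move=> [-> ->] [-> ->].
move=> [u [sC [t [L P ->]]]] [u' [sC' [t' [L' P' ->]]]].
have [eu es] := customer_loop_det L L'; subst u' sC'.
by have [-> ->] := IH _ _ _ P P'.
Qed.

Lemma core_returns_det (R : realType) (m : nat) (I : instance R m) (eps : R)
    (f : customer I -> 'rV[R]_m -> 'rV[R]_m) order T x1 x2 :
  core_returns eps f order T x1 -> core_returns eps f order T x2 -> x1 = x2.
Proof.
move=> [Y [S [Y0 P ->]]] [Y' [S' [Y'0 P' ->]]].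
have YE t : (t <= T)%N -> Y t = Y' t.
  elim: t => [|t IH] tT; first by rewrite Y0 Y'0.
  move: (P t tT) (P' t tT); rewrite IH ?(ltnW tT)// => p p'.
  by have [] := phase_det p p'.
congr (_ *: _); apply: eq_big_nat => -[|t] //= tT.
have tT' : (t < T)%N by [].
move: (P t tT') (P' t tT'); rewrite YE ?(ltnW tT')// => p p'.
by have [] := phase_det p p'.
Qed.

(* Main.v *)
Require Import Defs.
From mathcomp Require Import interval_inference ring lra.

Set Implicit Arguments.
Unset Strict Implicit.
Unset Printing Implicit Defensive.

Import Order.TTheory GRing.Theory Num.Theory.
Import numFieldNormedType.Exports.
Local Open Scope ring_scope.

(** Two customers share the block 1/2 * [p, q], where p = (1, 1, 0, ..., 0) and
    q = (1 + eta, 1 - delta, ..., 1 - delta) with eta exponentially small. Every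
    solution other than p has first entry greater than 1, so p is decreasingly
    minimal. In the algorithm, p is used only until the prices of the first two
    resources exceed the others by a factor of about m / delta, which takes
    O(ln (m / delta) / eps) phases. After that q is cheaper, because it saves
    delta on the second resource, whereas the price of the first resource has no
    time to make up for the factor eta. Hence the output is within O(delta)
    of q. *)

(** * Loads, and the block shared by both customers *)

Definition base (R : realType) (m : nat) : 'rV[R]_m :=
  \row_(r < m) (if (r < 2)%N then 1 else 0).

Definition shift (R : realType) (m : nat) (eta delta : R) : 'rV[R]_m :=
  \row_(r < m) (if (r == 0 :> nat)%N then eta
                else if (r == 1 :> nat)%N then - delta else 1 - delta).

(* The load after a total time a, a part th of which was spent on
   q = base + shift and the rest on p = base. *)
Definition load (R : realType) (m : nat) (eta delta a th : R) : 'rV[R]_m :=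
  a *: base R m + th *: shift m eta delta.

Definition price (R : realType) (m : nat) (eps eta delta a th : R) :
    'rV[R]_m :=
  \row_r expR (eps * load m eta delta a th 0 r).

(** The factor 1/2 keeps all entries of a block vector at most 1 when [eta] and [delta] lie in
    [0, 1], so every while loop ends after a single step of length 1. *)
Definition half_segment (R : realType) (m : nat) (eta delta : R) :
    set 'rV[R]_m :=
  [set load m eta delta 2^-1 th | th in `[0, 2^-1]]%classic.
Arguments half_segment {R} m eta delta _.

Section Vectors.
Context {R : realType} {m : nat}.
Implicit Types (x y : 'rV[R]_m) (eta delta a th : R).

Lemma innerDr y x1 x2 : inner y (x1 + x2) = inner y x1 + inner y x2.
Proof. by rewrite /inner -big_split; apply: eq_bigr => r _; rewrite mxE mulrDr. Qed.

Lemma innerZr y k x : inner y (k *: x) = k * inner y x.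
Proof. by rewrite /inner mulr_sumr; apply: eq_bigr => r _; rewrite mxE mulrCA. Qed.

Lemma inner_load y eta delta a th :
  inner y (load m eta delta a th) =
  a * inner y (base R m) + th * inner y (shift m eta delta).
Proof. by rewrite innerDr !innerZr. Qed.

Lemma loadD eta delta a1 th1 a2 th2 :
  load m eta delta (a1 + a2) (th1 + th2) =
  load m eta delta a1 th1 + load m eta delta a2 th2.
Proof. by rewrite /load !scalerDl addrACA. Qed.

Lemma loadZ eta delta k a th :
  load m eta delta (k * a) (k * th) = k *: load m eta delta a th.
Proof. by rewrite /load scalerDr !scalerA. Qed.

Lemma load_coord eta delta a th (r : 'I_m) :
  load m eta delta a th 0 r =
  if (r == 0 :> nat)%N then a + th * eta
  else if (r == 1 :> nat)%N then a - th * delta else th * (1 - delta).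
Proof.
rewrite !mxE; case: r => -[|[|r]] r_lt /=; first by rewrite mulr1.
  by rewrite mulr1 mulrN.
by rewrite mulr0 add0r.
Qed.

Lemma half_load_ge0_le1 eta delta th (r : 'I_m) :
  0 <= eta <= 1 -> 0 <= delta <= 1 -> 0 <= th <= 2^-1 ->
  0 <= load m eta delta 2^-1 th 0 r <= 1.
Proof.
by rewrite load_coord => e01 d01 th01; do !case: ifP => _; apply/andP; split; nra.
Qed.

Lemma vec_norm_le1 x : (forall r, `|x 0 r| <= 1) -> `|x| <= 1.
Proof.
move=> x_le1; rewrite -[`|x|]/(mx_norm x); have [->|x_neq0] := eqVneq (mx_norm x) 0.
  exact: ler01.
have [[i j] /= xE] := mx_norm_neq0 x_neq0.
by rewrite xE ord1.
Qed.

Lemma half_load_norm_le1 eta delta th :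
  0 <= eta <= 1 -> 0 <= delta <= 1 -> 0 <= th <= 2^-1 ->
  `|load m eta delta 2^-1 th| <= 1.
Proof.
move=> e01 d01 th01; apply: vec_norm_le1 => r.
by have /andP[? ?] := half_load_ge0_le1 r e01 d01 th01; rewrite ger0_norm.
Qed.

Lemma half_segment_ge0 eta delta x :
  0 <= eta <= 1 -> 0 <= delta <= 1 ->
  half_segment m eta delta x -> nonneg_vec x.
Proof.
move=> e01 d01 [th]; rewrite /= in_itv /= => th01 <- r.
by have /andP[] := half_load_ge0_le1 r e01 d01 th01.
Qed.

Lemma half_segment_neq0 eta delta : (half_segment m eta delta !=set0)%classic.
Proof.
by exists (load m eta delta 2^-1 0), 0; rewrite //= in_itv /= lexx invr_ge0 ler0n.
Qed.

Lemma half_segment_closed eta delta : closed (half_segment m eta delta).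
Proof.
apply: compact_closed; first exact: norm_hausdorff.
apply: continuous_compact; last exact: segment_compact.
apply: continuous_subspaceT => th.
by apply: cvgD; [exact: cvg_cst|exact: scalel_continuous].
Qed.

Lemma half_segment_convex eta delta : convex_set (half_segment m eta delta).
Proof.
move=> x y k /set_mem[s] + <- /set_mem[t] + <-; rewrite /= !in_itv /= => s01 t01.
apply/mem_set; exists (k%:num * s + (1 - k%:num) * t).
  have k0 : 0 <= k%:num by [].
  have k1 : k%:num <= 1 by [].
  by rewrite /= in_itv /=; apply/andP; split; nra.
rewrite -[RHS]/(k%:num *: load m eta delta 2^-1 s
  + (1 - k%:num) *: load m eta delta 2^-1 t).
by rewrite -!loadZ -loadD; congr load; ring.
Qed.

(** * The largest entry of a vector *)

Lemma mem_sort_dec x v : (v \in sort_dec x) = [exists r, v == x 0 r].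
Proof.
rewrite mem_sort; apply/mapP/existsP => [[r _ ->]|[r /eqP ->]]; exists r => //.
exact: mem_enum.
Qed.

Lemma size_sort_dec x : size (sort_dec x) = m.
Proof. by rewrite size_sort size_map size_enum_ord. Qed.

Lemma sort_dec0_ge x (r : 'I_m) : x 0 r <= (sort_dec x)`_0.
Proof.
have : x 0 r \in sort_dec x by rewrite mem_sort_dec; apply/existsP; exists r.
have : sorted >=%R (sort_dec x) by apply: sort_sorted => a b; exact: le_total.
case: (sort_dec x) => // h s /= hs; rewrite inE => /predU1P[->|] //.
have ge_trans : transitive (>=%R : rel R) by move=> a b c ba ac; exact: le_trans ba.
by move: (order_path_min ge_trans hs) => /allP /[apply].
Qed.

Lemma sort_dec0_mem x : (0 < m)%N -> exists r, (sort_dec x)`_0 = x 0 r.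
Proof.
move=> m_gt0; have : (sort_dec x)`_0 \in sort_dec x.
  by rewrite mem_nth // size_sort_dec.
by rewrite mem_sort_dec => /existsP[r /eqP]; exists r.
Qed.

End Vectors.

(** * The instance and its decreasingly minimal solution *)

Definition bad_instance (R : realType) (m : nat) (eta delta : R)
    (eta01 : 0 <= eta <= 1) (delta01 : 0 <= delta <= 1) : instance R m :=
  @Instance R m bool (fun=> half_segment m eta delta)
    (fun=> @half_segment_neq0 R m eta delta)
    (fun=> @half_segment_closed R m eta delta)
    (fun=> @half_segment_convex R m eta delta)
    (fun=> fun x => half_segment_ge0 eta01 delta01).

Section Instance.
Context {R : realType} {m : nat}.
Variables (eta delta : R).
Hypotheses (eta01 : 0 <= eta <= 1) (delta01 : 0 <= delta <= 1).
Let I := bad_instance m eta01 delta01.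

(** Every solution has the form [load m eta delta 1 (s + t)]. If [s + t] is positive, its entry 0
    exceeds 1, while no entry of [base] does, so the largest entries already decide the
    comparison. *)
Lemma base_dec_minimal : (2 < m)%N -> 0 < eta ->
  dec_minimal (solutions I) (base R m).
Proof.
move=> m_gt2 eta_gt0; have m_gt0 : (0 < m)%N by apply: leq_trans m_gt2.
have half2 : 2^-1 + 2^-1 = 1 :> R by lra.
split.
  exists (fun=> load m eta delta 2^-1 0) => [C|].
    by exists 0; rewrite //= in_itv /= lexx invr_ge0 ler0n.
  rewrite big_bool /= -loadD half2 addr0.
  by rewrite /load scale1r scale0r addr0.
move=> y [z zP ->]; rewrite big_bool /=.
have [s] := zP true; have [t] := zP false; rewrite /= !in_itv /=.
move=> /andP[t0 _] <- /andP[s0 _] <-; rewrite -loadD half2.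
have [st0|st_neq0] := eqVneq (s + t) 0.
  by left; rewrite st0 /load scale1r scale0r addr0.
right; exists (Ordinal m_gt0); split => //=.
have [r ->] := sort_dec0_mem (base R m) m_gt0.
apply: lt_le_trans (sort_dec0_ge _ (Ordinal m_gt0)).
rewrite load_coord /=; apply: (@le_lt_trans _ _ 1).
  by rewrite mxE; case: ifP.
by rewrite ltrDl mulr_gt0 // lt_def st_neq0 addr_ge0.
Qed.

(** The cost of a block vector is affine in [th] with slope [inner y (shift m eta delta)], so an
    endpoint of the segment is optimal. *)
Lemma exact_solver_exists :
  exists f : customer I -> 'rV[R]_m -> 'rV[R]_m, exact_block_solver f.
Proof.
exists (fun _ y => load m eta delta 2^-1
  (if inner y (shift m eta delta) <= 0 then 2^-1 else 0)); split.
  move=> C y _; eexists; last by [].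
  by rewrite /= in_itv /=; case: ifP => _; rewrite lexx ?andbT ?invr_ge0 ?ler0n.
move=> C y _ x [t]; rewrite /= in_itv /= => /andP[t0 t1] <-.
rewrite !inner_load lerD2l; case: (lerP _ 0) => D; first by rewrite ler_wnM2r.
by rewrite mul0r mulr_ge0 // ltW.
Qed.

End Instance.

(** * The run of the algorithm as a path in the parameters [a] and [th] *)

Section Trajectory.
Context {R : realType} {m : nat}.
Variables (eps : R).

Lemma price_coord eta delta a th (r : 'I_m) :
  price m eps eta delta a th 0 r = expR (eps * load m eta delta a th 0 r).
Proof. by rewrite mxE. Qed.

Lemma price_nonneg eta delta a th : nonneg_vec (price m eps eta delta a th).
Proof. by move=> r; rewrite mxE expR_ge0. Qed.

(** Prices are exponentials of accumulated loads, so they never leave this family with two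
    parameters. *)
Lemma update_price eta delta a th a' th' :
  update_prices eps 1 (load m eta delta a' th') (price m eps eta delta a th) =
  price m eps eta delta (a + a') (th + th').
Proof.
apply/rowP => r; rewrite [LHS]mxE !price_coord -expRD loadD.
by rewrite [in RHS]mxE mulr1 mulrDr.
Qed.

Lemma customer_loop_one (g : 'rV[R]_m -> 'rV[R]_m) y : `|g y| <= 1 ->
  customer_loop eps g 0 y 0 (update_prices eps 1 (g y) y) (g y).
Proof.
move=> g_le1; have step1 : step_size 0 (g y) = 1.
  rewrite /step_size subr0; case: ifPn => // g_neq0.
  by apply: min_idPl; rewrite ler_pdivlMr ?normr_gt0 // mul1r.
apply: loop_step => //=; rewrite step1 !add0r scale1r.
exact: loop_exit.
Qed.

End Trajectory.

(* Compares p and q at the prices reached: their difference in cost is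
   exp(eps (a - th delta)) times a bracket whose first term is kept below
   delta / 2 by the choice of eta, and the last one by a - th being large. *)
Lemma shift_cost_lt0 (R : realType) (n : nat) (eps eta delta a th : R) :
  0 < delta < 1 -> eta * expR (eps * (eta + delta) * th) <= delta / 2 ->
  n.+2%:R * expR (- (eps * (a - th))) < delta / 2 ->
  inner (price n.+2 eps eta delta a th) (shift n.+2 eta delta) < 0.
Proof.
move=> d01 eta_small gap_big.
rewrite /inner !big_ord_recl /= (eq_bigr
  (fun=> expR (eps * (th * (1 - delta))) * (1 - delta))); last first.
  by move=> i _; rewrite price_coord load_coord mxE.
rewrite sumr_const card_ord !price_coord !load_coord !mxE /=.
set E := expR (eps * (a - th * delta)).
have E_gt0 : 0 < E by exact: expR_gt0.
have -> : expR (eps * (a + th * eta)) = E * expR (eps * (eta + delta) * th).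
  by rewrite -expRD; congr expR; ring.
have -> : expR (eps * (th * (1 - delta))) = E * expR (- (eps * (a - th))).
  by rewrite -expRD; congr expR; ring.
move: eta_small gap_big; set u := expR _; set v := expR _ => eta_small gap_big.
have v_gt0 : 0 < v by exact: expR_gt0.
have -> : E * u * eta + (E * - delta + (E * v * (1 - delta)) *+ n) =
    E * (eta * u - delta + (1 - delta) * (n%:R * v)).
  by rewrite -mulr_natl; ring.
rewrite pmulr_rlt0 //.
have nv_lt : n%:R * v < delta / 2.
  by apply: le_lt_trans gap_big; rewrite ler_pM2r // ler_nat ltnW.
have nv_ge0 : 0 <= n%:R * v by rewrite mulr_ge0 // ltW.
by nra.
Qed.

(** The first summand is the lag [a - th] at which [m * exp (- eps * (a - th))] equals [delta / 2];
    beyond it, q is strictly cheaper. The second is the most that one oracle answer can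
    overshoot. *)
Definition lag_bound (R : realType) (m : nat) (delta eps : R) : R :=
  ln (2 * m%:R / delta) / eps + 2^-1.

(** Below the threshold, one answer raises the lag by at most 1/2. Above it, the answer must be the
    endpoint q/2, which leaves the lag unchanged. *)
Lemma solver_step (R : realType) (n : nat) (eps eta delta N a th : R)
    (eta01 : 0 <= eta <= 1) (delta01 : 0 <= delta <= 1)
    (f : customer (bad_instance n.+2 eta01 delta01) ->
         'rV[R]_n.+2 -> 'rV[R]_n.+2)
    (C : customer (bad_instance n.+2 eta01 delta01)) :
  exact_block_solver f ->
  0 < eps -> 0 < delta < 1 -> eta * expR (2 * eps * N) <= delta / 2 ->
  0 <= th <= a -> a <= N -> a - th <= lag_bound n.+2 delta eps ->
  exists2 th', f C (price n.+2 eps eta delta a th) = load n.+2 eta delta 2^-1 th'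
    & 0 <= th' <= 2^-1 /\ a + 2^-1 - (th + th') <= lag_bound n.+2 delta eps.
Proof.
move=> [f_in f_min] eps_gt0 d01 eta_small th_bd a_leN lag.
set y := price _ _ _ _ _ _; have y_ge0 : nonneg_vec y by exact: price_nonneg.
have [th'] := f_in C y y_ge0; rewrite /= in_itv /= => th'_bd fE.
exists th' => //; split => //; have [lag_small|lag_big] :=
  lerP (a - th) (ln (2 * n.+2%:R / delta) / eps).
  by rewrite /lag_bound; lra.
suff -> : th' = 2^-1 by rewrite opprD addrACA subrr addr0.
have D_lt0 : inner y (shift n.+2 eta delta) < 0.
  apply: shift_cost_lt0 => //.
    apply: le_trans eta_small; rewrite ler_wpM2l //; first by have /andP[] := eta01.
    have exp_le : (eta + delta) * th <= 2 * N by nra.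
    by rewrite ler_expR -mulrA [2 * eps]mulrC -mulrA ler_pM2l.
  have d_gt0 : 0 < delta by case/andP: d01.
  have q_gt0 : 0 < 2 * n.+2%:R / delta by rewrite divr_gt0 ?mulr_gt0.
  have : expR (ln (2 * n.+2%:R / delta)) < expR (eps * (a - th)).
    by rewrite ltr_expR [eps * _]mulrC -ltr_pdivrMr.
  rewrite lnK ?posrE // ltr_pdivrMr // => exp_lt.
  by rewrite expRN ltr_pdivrMr ?expR_gt0 //; lra.
(* The slope in [th] is negative, so comparing with the endpoint forces [th'] to be at least 1/2. *)
have := f_min C y y_ge0 (load n.+2 eta delta 2^-1 2^-1).
rewrite -fE !inner_load => /(_ _)/wrap[].
  by exists 2^-1 => //=; rewrite in_itv /= lexx invr_ge0 ler0n.
rewrite lerD2l ler_nM2r // => half_le.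
by apply/eqP; rewrite eq_le half_le; case/andP: th'_bd => _ ->.
Qed.

(** Induction over the phases, each consisting of two applications of [solver_step] that advance [a]
    by 1/2. *)
Lemma core_run (R : realType) (n : nat) (eps eta delta : R) (T : nat)
    (eta01 : 0 <= eta <= 1) (delta01 : 0 <= delta <= 1)
    (f : customer (bad_instance n.+2 eta01 delta01) ->
         'rV[R]_n.+2 -> 'rV[R]_n.+2)
    (order : seq (customer (bad_instance n.+2 eta01 delta01))) :
  exact_block_solver f ->
  perm_eq order (enum (customer (bad_instance n.+2 eta01 delta01))) ->
  0 < eps -> 0 < delta < 1 -> eta * expR (2 * eps * T%:R) <= delta / 2 ->
  exists2 th,
    core_returns eps f order T (T%:R^-1 *: load n.+2 eta delta T%:R th)
    & 0 <= th <= T%:R /\ T%:R - th <= lag_bound n.+2 delta eps.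
Proof.
move=> f_exact /perm_size; rewrite -cardE card_bool.
case: order => [|A [|B []]] // _ eps_gt0 d01 eta_small.
pose next C y := update_prices eps 1 (f C y) y.
pose Y t := iter t (next B \o next A) (const_mx 1).
(* Phase [t] starts from the prices [Y t.-1]. The value [S 0] merely repeats [S 1] and stays outside
   the sums, which start at 1. *)
pose S t := f A (Y t.-1) + f B (next A (Y t.-1)).
have lag0 : 0 <= lag_bound n.+2 delta eps.
  rewrite addr_ge0 ?invr_ge0 // divr_ge0 ?(ltW eps_gt0) // ln_ge0 //.
  case/andP: d01 => d0 d1; rewrite ler_pdivlMr // mul1r.
  have : 1 <= n.+2%:R :> R by rewrite ler1n.
  by lra.
pose inv (a th : R) := 0 <= th <= a /\ a - th <= lag_bound n.+2 delta eps.
have step C (a th : R) : a + 2^-1 <= T%:R -> inv a th ->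
    let y := price n.+2 eps eta delta a th in
    exists2 th', inv (a + 2^-1) (th + th') &
      [/\ customer_loop eps (f C) 0 y 0 (next C y) (f C y),
          next C y = price n.+2 eps eta delta (a + 2^-1) (th + th')
        & f C y = load n.+2 eta delta 2^-1 th'].
  move=> aT [th_bd lag] y; have a_leT : a <= T%:R by lra.
  have [th' fE [th'_bd lag']] :=
    solver_step C f_exact eps_gt0 d01 eta_small th_bd a_leT lag.
  exists th'; first by split=> //; apply/andP; split; lra.
  split=> //; last by rewrite /next fE update_price.
  by apply: customer_loop_one; rewrite fE half_load_norm_le1.
have phase_step (t : nat) (th : R) : (t < T)%N -> inv t%:R th ->
    Y t = price n.+2 eps eta delta t%:R th ->
    exists2 th', inv t.+1%:R (th + th') &
      [/\ phase eps f [:: A; B] (Y t) (Y t.+1) (S t.+1),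
          Y t.+1 = price n.+2 eps eta delta t.+1%:R (th + th')
        & S t.+1 = load n.+2 eta delta 1 th'].
  move=> t_ltT t_inv YE.
  have tT : t%:R + 1 <= T%:R :> R by rewrite natr1 ler_nat.
  have t1E : t%:R + 2^-1 + 2^-1 = t.+1%:R :> R by rewrite -[t.+1%:R]natr1; lra.
  have tT1 : t%:R + 2^-1 <= T%:R :> R by lra.
  have [th1 inv1 [loop1 Y1 f1]] := step A _ _ tT1 t_inv.
  have tT2 : t%:R + 2^-1 + 2^-1 <= T%:R :> R by lra.
  have [th2 inv2 [loop2 Y2 f2]] := step B _ _ tT2 inv1.
  rewrite -YE in loop1 Y1 f1; rewrite -Y1 in loop2 Y2 f2.
  rewrite t1E -addrA in inv2 Y2.
  exists (th1 + th2) => //; split=> //.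
    exists (next A (Y t)), (f A (Y t)), (f B (next A (Y t))); split=> //=.
    exists (next B (next A (Y t))), (f B (next A (Y t))), 0.
    by split=> //; rewrite addr0.
  rewrite /S /= f1 f2 -loadD; congr load; lra.
have run t : (t <= T)%N -> exists2 th, inv t%:R th &
    Y t = price n.+2 eps eta delta t%:R th /\
    \sum_(1 <= i < t.+1) S i = load n.+2 eta delta t%:R th.
  elim: t => [|t IH] t_leT.
    exists 0; first by split; rewrite ?lexx // subr0.
    split; last by rewrite big_geq // /load !scale0r addr0.
    by apply/rowP => r; rewrite !mxE !mul0r addr0 mulr0 expR0.
  have [th t_inv [YE sumE]] := IH (ltnW t_leT).
  have [th' t1_inv [_ Y1E SE]] := phase_step _ _ t_leT t_inv YE.
  exists (th + th') => //; split=> //.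
  by rewrite big_nat_recr //= sumE SE -[t.+1%:R]natr1 loadD.
have [th th_inv [_ sumE]] := run T (leqnn T).
exists th => //; exists Y, S; split=> //; last by rewrite sumE.
move=> t t_ltT; have [th' t_inv [YE _]] := run t (ltnW t_ltT).
by have [? _ []] := phase_step _ _ t_ltT t_inv YE.
Qed.

(** * Numerical estimates and conclusion *)

Lemma ln_nat_ge (R : realType) (m : nat) : (2 < m)%N -> 2 / 3 <= ln (m%:R : R).
Proof.
move=> m_gt2; have m3 : 3 <= m%:R :> R by rewrite ler_nat.
have m_gt0 : 0 < m%:R :> R by lra.
have mV : m%:R^-1 <= 3^-1 :> R by rewrite lef_pV2 // posrE; lra.
have mV_gt0 : 0 < m%:R^-1 :> R by rewrite invr_gt0.
(* The right-hand side is at most -2/3, and the left-hand side is [- ln m]. *)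
have : ln (1 + (m%:R^-1 - 1)) <= m%:R^-1 - 1 :> R by apply: le_ln1Dx; lra.
rewrite addrC subrK lnV ?posrE //; lra.
Qed.

(** The bound on [eps] gives [delta / eps >= 4 / delta], so it suffices that
    [ln (2 * m / delta) + eps / 2] is at most [4 / delta * ln m]. This follows from
    [ln (2 / delta) <= 2 / delta], [ln m >= 2 / 3] and the smallness of [delta] and [eps]. *)
Lemma lag_bound_le (R : realType) (m : nat) (delta eps T : R) :
  (2 < m)%N -> 0 < delta <= 1 / 8 -> 0 < eps < delta ^+ 2 / 4 ->
  ln (m%:R : R) / eps ^+ 2 <= T -> lag_bound m delta eps <= delta * T.
Proof.
move=> m_gt2 /andP[d_gt0 d_le] /andP[eps_gt0 eps_lt] T_ge.
have L_ge := @ln_nat_ge R _ m_gt2.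
have m_gt0 : 0 < m%:R :> R by rewrite ltr0n; apply: leq_trans m_gt2.
have dV_ge : 8 <= delta^-1 by rewrite -[8]invrK lef_pV2 ?posrE //; lra.
apply: (@le_trans _ _ (delta * (ln (m%:R : R) / eps ^+ 2))); last first.
  by rewrite ler_pM2l.
have -> : delta * (ln (m%:R : R) / eps ^+ 2) = delta / eps * ln (m%:R : R) / eps.
  by field; rewrite gt_eqF.
have -> : lag_bound m delta eps = (ln (2 * m%:R / delta) + eps / 2) / eps.
  by rewrite /lag_bound; field; rewrite gt_eqF.
rewrite ler_pM2r ?invr_gt0 //.
have -> : 2 * m%:R / delta = m%:R * (2 / delta) by ring.
have q_gt0 : 0 < 2 / delta by rewrite divr_gt0.
rewrite lnM ?posrE //.
have lnq := ltW (ln_sublinear q_gt0).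
have ratio : 4 / delta <= delta / eps.
  by rewrite ler_pdivrMr // mulrAC ler_pdivlMr //; nra.
apply: (@le_trans _ _ (4 / delta * ln (m%:R : R))); last first.
  by rewrite ler_wpM2r //; lra.
by nra.
Qed.

Theorem theorem8 (R : realType) (m : nat) (delta : R) (K : nat) (eps : R)
    (m_ge3 : (3 <= m)%N) (delta_gt0 : 0 < delta) (delta_le : delta <= 1 / 8)
    (K_gt0 : (0 < K)%N)
    (eps_gt0 : 0 < eps) (eps_lt : eps < 1 / (4 * K%:R) * delta ^+ 2) :
  exists I : instance R m,
    [/\ dec_minimal (solutions I) (\row_(r < m) (if (r < 2)%N then 1 else 0)),
        exists f : customer I -> 'rV[R]_m -> 'rV[R]_m, exact_block_solver f
      & forall (f : customer I -> 'rV[R]_m -> 'rV[R]_m)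
               (order : seq (customer I)) (T : nat),
          exact_block_solver f ->
          perm_eq order (enum (customer I)) ->
          Num.ceil (ln (m%:R : R) / eps ^+ 2) <= T%:Z ->
          T%:Z <= Num.ceil (K%:R * ln (m%:R : R) / eps ^+ 2) ->
          exists2 x : 'rV[R]_m,
            core_returns eps f order T x
            & forall r : 'I_m, 1 - 2 * delta <= x 0 r].

Proof.
case: m m_ge3 => [|[|n]] // m_ge3.
have d01 : 0 <= delta <= 1 by apply/andP; split; lra.
have d01' : 0 < delta < 1 by apply/andP; split; lra.
(* The summand 1 absorbs the rounding up, so [N] bounds all admissible [T] at once. *)
pose N : R := K%:R * ln (n.+2%:R : R) / eps ^+ 2 + 1.
(* Chosen so that [eta * expR (2 * eps * N)] equals [delta / 2]; the instance thus does not depend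
   on [T]. *)
pose eta := delta / 2 * expR (- (2 * eps * N)).
have eta_gt0 : 0 < eta by rewrite mulr_gt0 ?expR_gt0 // divr_gt0.
have L_ge := @ln_nat_ge R _ m_ge3.
have N_ge0 : 0 <= N.
  by rewrite addr_ge0 // divr_ge0 ?mulr_ge0 ?exprn_ge0 //; lra.
have eta01 : 0 <= eta <= 1.
  rewrite (ltW eta_gt0) /=; have : expR (- (2 * eps * N)) <= 1.
    by rewrite -expR0 ler_expR oppr_le0 !mulr_ge0 // ltW.
  by rewrite /eta; nra.
have eps_lt' : eps < delta ^+ 2 / 4.
  apply: lt_le_trans eps_lt _; rewrite mulrC ler_pM2l ?exprn_gt0 //.
  have K1 : 1 <= K%:R :> R by rewrite ler1n.
  by rewrite div1r lef_pV2 ?posrE //; lra.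
exists (bad_instance n.+2 eta01 d01); split.
- exact: base_dec_minimal.
- exact: exact_solver_exists.
move=> f order T f_exact order_perm; rewrite ceil_le_int => T_ge T_le.
have T_leN : T%:R <= N.
  have : T%:~R <= (Num.ceil (K%:R * ln (n.+2%:R : R) / eps ^+ 2))%:~R :> R.
    by rewrite ler_int.
  have /andP[+ _] := ceil_itv (K%:R * ln (n.+2%:R : R) / eps ^+ 2).
  by rewrite intrD /N; lra.
have T_gt0 : 0 < T%:R :> R.
  apply: lt_le_trans T_ge; rewrite divr_gt0 ?exprn_gt0 //; lra.
have lag_small : lag_bound n.+2 delta eps <= delta * T%:R.
  by apply: lag_bound_le => //; rewrite ?delta_gt0 ?eps_gt0.
have eta_small : eta * expR (2 * eps * T%:R) <= delta / 2.
  rewrite /eta -(mulrA (delta / 2)) -expRD ler_piMr ?divr_ge0 ?(ltW delta_gt0) //.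
  rewrite -[leRHS]expR0 ler_expR.
  by rewrite addrC subr_le0 ler_pM2l ?mulr_gt0.
have [th ret [/andP[th_ge0 th_le] lag]] :=
  core_run f_exact order_perm eps_gt0 d01' eta_small.
exists (T%:R^-1 *: load n.+2 eta delta T%:R th) => // r.
(* As [T - th <= delta * T], entries from index 2 on are at least [(1 - delta)^2 * T] before
   division by [T], hence at least [(1 - 2 * delta) * T]. Entry 1 loses at most [delta * T], entry 0
   nothing. *)
rewrite mxE [_^-1 * _]mulrC ler_pdivlMr // load_coord.
by do !case: ifP => _; nra.
Qed.
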